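(* For any $n\in\mathbb{Z}_+$ and $z\in\mathcal{D}\setminus\{-\alpha,\alpha\}$ we have $$\tau\bigl(U_n(z)\bigr)=\tau(z)+\omega_n\qquad\text{and}\qquad \sigma\bigl(U_n(z)\bigr)=\sigma(z).$$
   Context: $\mathcal{D}$ is the open unit disk in $\mathbb{C}$ centered at $0$, $\overline{\mathcal{D}}$ its closure, $\partial\mathcal{D}$ the unit circle. Fix $\alpha\in\partial\mathcal{D}$. For $x\in(-1,1)$ let $q_{x,\alpha}(z)=\frac{z+x\alpha}{1+x\bar\alpha z}$ for $z\in\overline{\mathcal{D}}$. For $\gamma\in\mathbb{R}$ let $g_\gamma:=q_{x,\alpha}$ where $x\in(-1,1)$ is determined by $\gamma=\log\frac{1+x}{1-x}$. Let $(x_n)_{n\in\mathbb{N}}$ be a stationary and ergodic sequence of random variables with values in $(-1,1)$; put $\gamma_n=\log\frac{1+x_n}{1-x_n}$, $\omega_0=0$, $\omega_n=\sum_{i=1}^n\gamma_i$, and $U_n:=g_{\omega_n}$ for $n\in\mathbb{Z}_+=\mathbb{N}\cup\{0\}$. The claim holds for every realization of the sequence. Bipolar coordinates associated with $(\alpha,-\alpha)$: $\tau(z)=\log\frac{|z+\alpha|}{|z-\alpha|}$, and $\sigma(z)=\operatorname{sign}(\operatorname{Im}(\bar\alpha z))\cdot\angle(-\alpha,z,\alpha)$, where $\angle(A,B,C)\in(0,\pi]$ is the (Euclidean) angle at the vertex $B$ of the triangle with vertices $A,B,C$ in the complex plane; by convention $\sigma(z)=\pi$ if $z\in l_\alpha=\{x\alpha:x\in(-1,1)\}$.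 *)

(* Defs.v *)
From HB Require Import structures.
From mathcomp Require Import all_boot all_order all_algebra.
From mathcomp Require Import all_classical all_reals all_analysis.
From mathcomp Require Export complex.
From mathcomp Require Import ring lra.

Set Implicit Arguments.
Unset Strict Implicit.
Unset Printing Implicit Defensive.

Import Order.TTheory GRing.Theory Num.Theory Normc.

Local Open Scope classical_set_scope.
Local Open Scope ring_scope.
Local Open Scope complex_scope.

Section disk.
Context {R : realType}.
Implicit Types (alpha z A B C : R[i]) (x gam : R).

Definition unit_disk : set R[i] := [set z | normc z < 1].

Definition unit_circle : set R[i] := [set z | normc z = 1].

Definition q x alpha z : R[i] :=
  (z + x%:C * alpha) / (1 + x%:C * alpha^* * z).

Definition log_ratio x : R := ln ((1 + x) / (1 - x)).

Lemma log_ratio_bij gam : exists! x, -1 < x < 1 /\ gam = log_ratio x.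
Proof.
have e0 := expR_gt0 gam.
exists ((expR gam - 1) / (expR gam + 1)); split; first split.
- by rewrite ltr_pdivlMr ?ltr_pdivrMr; lra.
- rewrite /log_ratio (_ : _ / _ = expR gam) ?expRK //.
  by field; apply/andP; split; apply/eqP; lra.
- move=> x [/andP[x1 x2] ->]; rewrite /log_ratio lnK; last first.
    by rewrite posrE divr_gt0; lra.
  by field; apply/andP; split; apply/eqP; lra.
Qed.

Definition g gam alpha : R[i] -> R[i] :=
  q (get [set x | -1 < x < 1 /\ gam = log_ratio x]) alpha.

Definition tau alpha z : R := ln (normc (z + alpha) / normc (z - alpha)).

(* Unoriented angle at the vertex [B], from the Euclidean inner product
   [complex.Re (u * v^* )] on the plane; meaningful when [A != B] and [C != B]. *)
Definition angle A B C : R :=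
  acos (complex.Re ((A - B) * (C - B)^*) / (normc (A - B) * normc (C - B))).

Definition diameter alpha : set R[i] :=
  [set x%:C * alpha | x in `]-1, 1[%classic].

Definition sigma alpha z : R :=
  if z \in diameter alpha then pi
  else Num.sg (complex.Im (alpha^* * z)) * angle (- alpha) z alpha.

(* The sequence is indexed from 0 here: [x n] is the term $x_{n+1}$. *)
Definition omega (x : nat -> R) (n : nat) : R :=
  \sum_(i < n) log_ratio (x i).

Definition U alpha (x : nat -> R) (n : nat) : R[i] -> R[i] :=
  g (omega x n) alpha.

End disk.

Section stationary_ergodic.
Context {R : realType} {d : measure_display} {T : measurableType d}.
Variable P : probability T R.

Definition seq_shift (u : nat -> R) : nat -> R := fun n => u n.+1.

(* product sigma-algebra on $R^N$ *)
Definition seq_measurable : set (set (nat -> R)) :=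
  <<s [set A | exists (n : nat) (B : set R),
         measurable B /\ A = [set u | B (u n)]] >>.

Definition stationary (x : nat -> {RV P >-> R}) : Prop :=
  forall A, seq_measurable A ->
    P [set t | A (seq_shift (fun n => x n t))] = P [set t | A (fun n => x n t)].

Definition ergodic (x : nat -> {RV P >-> R}) : Prop :=
  forall A, seq_measurable A -> seq_shift @^-1` A = A ->
    P [set t | A (fun n => x n t)] = 0%E \/
    P [set t | A (fun n => x n t)] = 1%E.

End stationary_ergodic.

(* Main.v *)
(** Put [D = 1 + y alpha^* z], for [y] in [(-1, 1)]. The Moebius map [w = q y alpha z]
    satisfies [w + alpha = (1 + y) (z + alpha) / D] and
    [w - alpha = (1 - y) (z - alpha) / D]. The quotient of the moduli gives
    the translation of [tau] by [log ((1 + y) / (1 - y))]. The two sides of the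
    angle at [w] are positive multiples of those at [z] rotated by the same
    factor [1 / D], so the angle is unchanged, and
    [Im (alpha^* w) = (1 - y^2) Im (alpha^* z) / |D|^2] keeps its sign. *)
Require Import Defs.
From mathcomp Require Import all_boot all_order all_algebra.
From mathcomp Require Import all_classical all_reals all_analysis.
From mathcomp Require Import ring lra.

Import Order.TTheory GRing.Theory Num.Theory Normc.

Local Open Scope classical_set_scope.
Local Open Scope ring_scope.
Local Open Scope complex_scope.

Section bipolar.
Context {R : realType}.
Implicit Types (alpha z c A B C : R[i]) (a b x y gam : R).

Lemma normc_real_ge0 a : 0 <= a -> normc a%:C = a.
Proof. by move=> a0; rewrite /= expr0n addr0 sqrtr_sqr ger0_norm. Qed.

Lemma normc_conj z : normc z^*%R = normc z.
Proof. by case: z => a b; rewrite -[Num.conj _]/(a -i* b) /= sqrrN. Qed.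

Lemma conj_real a : (a%:C^*)%R = a%:C.
Proof. exact: conjc_real. Qed.

Lemma Re_realM a z : complex.Re (a%:C * z) = a * complex.Re z.
Proof. by case: z => u v /=; rewrite mul0r subr0. Qed.

Lemma mulcJ z : z * z^* = (normc z ^+ 2)%:C.
Proof. by rewrite -sqr_normc rmorphXn. Qed.

Lemma normc_ge0 z : 0 <= normc z.
Proof. by case: z => u v; rewrite sqrtr_ge0. Qed.

Lemma normc_gt0 z : (0 < normc z) = (z != 0).
Proof.
rewrite lt_def normc_ge0 andbT; congr (~~ _); apply/eqP/eqP => [|->].
  exact: eq0_normc.
exact: normc0.
Qed.

(** The inner product of the two sides and the product of their lengths both pick up the factor
    [a * b * normc c ^+ 2], which is positive and cancels under [acos]. *)
Lemma angle_similar a b c A B C A' B' C' : 0 < a -> 0 < b -> c != 0 ->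
  A' - B' = a%:C * c * (A - B) -> C' - B' = b%:C * c * (C - B) ->
  angle A' B' C' = angle A B C.
Proof.
move=> a0 b0 c0 hA hC; rewrite /angle hA hC; congr acos.
have -> : a%:C * c * (A - B) * (b%:C * c * (C - B))^*
    = (a * b * normc c ^+ 2)%:C * ((A - B) * (C - B)^*).
  by rewrite !(rmorphM Num.conj) /= conj_real 2!(rmorphM (real_complex R)) /= -mulcJ; ring.
rewrite Re_realM !normcM !normc_real_ge0 ?ltW//.
have n0 : 0 < normc c by rewrite normc_gt0.
set u := normc (A - B); set v := normc (C - B).
have -> : a * normc c * u * (b * normc c * v) = (a * b * normc c ^+ 2) * (u * v).
  by ring.
by rewrite -mulf_div divff ?mul1r// gt_eqF// !mulr_gt0 ?exprn_gt0.
Qed.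

(** A zero would give [y * alpha^* * z = -1], hence [|y| * normc z = 1], with both factors below
    1. *)
Lemma q_denom_neq0 alpha y z : normc alpha = 1 -> normc z < 1 -> -1 < y < 1 ->
  1 + y%:C * alpha^* * z != 0.
Proof.
move=> ha hz hy; apply/eqP => /eqP; rewrite addrC addr_eq0 => /eqP e.
have : normc (y%:C * alpha^* * z) = 1 by rewrite e normcN normc1.
rewrite !normcM normc_conj ha mulr1 /= expr0n addr0 sqrtr_sqr => e1.
have y1 : `|y| < 1 by rewrite ltr_norml.
have : `|y| * normc z < 1 * 1 by rewrite ltr_pM ?normc_ge0 ?normr_ge0.
by rewrite e1 mulr1 ltxx.
Qed.

Lemma qD alpha y z : alpha * alpha^* = 1 -> 1 + y%:C * alpha^* * z != 0 ->
  q y alpha z + alpha = (1 + y)%:C * (1 + y%:C * alpha^* * z)^-1 * (z + alpha).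
Proof.
move=> ha D0; apply: (mulIf D0); rewrite mulrDl /q divfK//.
rewrite [RHS]mulrAC divfK// rmorphD rmorph1.
have -> : alpha * (1 + y%:C * alpha^* * z) = alpha + y%:C * (alpha * alpha^*) * z.
  by ring.
by rewrite ha; ring.
Qed.

Lemma qB alpha y z : alpha * alpha^* = 1 -> 1 + y%:C * alpha^* * z != 0 ->
  q y alpha z - alpha = (1 - y)%:C * (1 + y%:C * alpha^* * z)^-1 * (z - alpha).
Proof.
move=> ha D0; apply: (mulIf D0); rewrite mulrBl /q divfK//.
rewrite [RHS]mulrAC divfK// rmorphB rmorph1.
have -> : alpha * (1 + y%:C * alpha^* * z) = alpha + y%:C * (alpha * alpha^*) * z.
  by ring.
by rewrite ha; ring.
Qed.

Lemma Im_conjM_q alpha y z : alpha * alpha^* = 1 ->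
  1 + y%:C * alpha^* * z != 0 ->
  complex.Im (alpha^* * q y alpha z)
    = (1 - y ^+ 2) / normc (1 + y%:C * alpha^* * z) ^+ 2 * complex.Im (alpha^* * z).
Proof.
move=> ha D0; set D := 1 + _ in D0 *.
have n0 : normc D != 0 by rewrite gt_eqF// normc_gt0.
have e : (normc D ^+ 2)%:C * (alpha^* * q y alpha z)
    = (alpha^* * z + y%:C) * (1 + y%:C * (alpha^* * z)^*).
  have eD : D^*%R = 1 + y%:C * (alpha^* * z)^*.
    by rewrite /D -mulrA rmorphD rmorph1 /= [X in _ + X = _]rmorphM /= conj_real.
  rewrite -mulcJ -eD /q -/D.
  have -> : alpha^* * z + y%:C = alpha^* * (z + y%:C * alpha).
    by rewrite mulrDr mulrCA [alpha^* * alpha]mulrC ha mulr1.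
  by move: (D) D0 (alpha^*%R) (D^*%R) (z + _) => E E0 ? ? ?; field.
have ImZ a w : complex.Im (a%:C * w) = a * complex.Im w.
  by case: w => u v /=; rewrite mul0r addr0.
apply: (mulfI (expf_neq0 2 n0)); rewrite -ImZ e.
rewrite mulrA [_ * (_ / _)]mulrC divfK ?expf_neq0//.
by case: (alpha^* * z) => u v /=; ring.
Qed.

(** Multiplication by [alpha^*] is a rotation that carries the diameter to the real interval (-1,
    1). *)
Lemma diameterP alpha z : alpha * alpha^* = 1 -> normc z < 1 ->
  diameter alpha z <-> complex.Im (alpha^* * z) = 0.
Proof.
move=> ha hz; split.
  by case=> s _ <-; rewrite mulrCA [alpha^* * _]mulrC ha mulr1.
move=> h0; have ha1 : normc alpha = 1.
  have : (normc alpha ^+ 2)%:C = 1 by rewrite -mulcJ.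
  by case=> /eqP; rewrite sqrp_eq1 ?normc_ge0// => /eqP.
have e : (complex.Re (alpha^* * z))%:C = alpha^* * z.
  by move: h0; case: (alpha^* * z) => u v /= ->.
exists (complex.Re (alpha^* * z)); last by rewrite e mulrC mulrA ha mul1r.
rewrite /= in_itv /= -ltr_norml.
have : normc (complex.Re (alpha^* * z))%:C < 1 by rewrite e normcM normc_conj ha1 mul1r.
by rewrite /= expr0n addr0 sqrtr_sqr.
Qed.

(** In the real coordinate [s] along the diameter, the map is [s |-> (s + y) / (1 + y * s)], which
    preserves (-1, 1). *)
Lemma q_diameter alpha y z : -1 < y < 1 -> alpha * alpha^* = 1 ->
  diameter alpha z -> diameter alpha (q y alpha z).
Proof.
move=> /andP[y1 y2] ha [s /=]; rewrite in_itv /= => /andP[s1 s2] <-.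
have D0 : 0 < 1 + y * s by nra.
exists ((s + y) / (1 + y * s)).
  by rewrite /= in_itv /= ltr_pdivlMr// ltr_pdivrMr//; apply/andP; split; nra.
rewrite /q; have -> : 1 + y%:C * alpha^* * (s%:C * alpha) = (1 + y * s)%:C.
  rewrite rmorphD rmorph1 rmorphM -(mulr1 (y%:C * s%:C)) -ha; ring.
by rewrite rmorphM fmorphV rmorphD; ring.
Qed.

Lemma tau_q alpha y z : normc alpha = 1 -> normc z < 1 -> -1 < y < 1 ->
  z != alpha -> z != - alpha ->
  tau alpha (q y alpha z) = tau alpha z + log_ratio y.
Proof.
move=> ha hz hy za zNa.
have ha2 : alpha * alpha^* = 1 by rewrite mulcJ ha expr1n.
have D0 := q_denom_neq0 alpha y z ha hz hy.
have /andP[y1 y2] := hy.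
rewrite /tau /log_ratio qD// qB//.
have zp : 0 < normc (z + alpha) by rewrite normc_gt0 addr_eq0.
have zm : 0 < normc (z - alpha) by rewrite normc_gt0 subr_eq0.
have n0 : 0 < normc (1 + y%:C * alpha^* * z) by rewrite normc_gt0.
have yp : 0 < 1 + y by lra.
have ym : 0 < 1 - y by lra.
(* Since [z] avoids both poles, the logarithms merge, and the modulus of the denominator cancels in
   the quotient. *)
rewrite -lnM ?posrE ?divr_gt0//; congr ln.
rewrite !normcM normcV !normc_real_ge0 ?ltW//.
by field; rewrite !gt_eqF.
Qed.

Lemma sigma_q alpha y z : normc alpha = 1 -> normc z < 1 -> -1 < y < 1 ->
  sigma alpha (q y alpha z) = sigma alpha z.
Proof.
move=> ha hz hy.
have ha2 : alpha * alpha^* = 1 by rewrite mulcJ ha expr1n.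
have D0 := q_denom_neq0 alpha y z ha hz hy.
have /andP[y1 y2] := hy.
have k0 : 0 < (1 - y ^+ 2) / normc (1 + y%:C * alpha^* * z) ^+ 2.
  by rewrite divr_gt0 ?exprn_gt0 ?normc_gt0//; nra.
have hI := Im_conjM_q alpha y z ha2 D0.
rewrite /sigma; have -> : (q y alpha z \in diameter alpha) = (z \in diameter alpha).
  apply/idP/idP; rewrite !inE; last exact: q_diameter.
  (* If the image lies on the diameter, the left side of [hI] vanishes; its positive factor then
     forces [Im (alpha^* * z) = 0]. *)
  case=> s _ hs; apply/diameterP => //.
  have hs0 : complex.Im (alpha^* * (s%:C * alpha)) = 0.
    by rewrite mulrCA [alpha^* * _]mulrC ha2 mulr1.
  move/eqP: hI; rewrite -hs hs0 eq_sym.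
  by rewrite mulf_eq0 gt_eqF//= => /eqP.
case: ifP => // _; rewrite hI sgrM gtr0_sg// mul1r; congr (_ * _).
(* The side towards [- alpha] is stretched by [1 + y], the side towards [alpha] by [1 - y]. *)
apply: (@angle_similar (1 + y) (1 - y) (1 + y%:C * alpha^* * z)^-1); rewrite ?invr_eq0//.
- by lra.
- by lra.
- by rewrite -opprD addrC qD// -mulrN opprD [- z - _]addrC.
- by rewrite -opprB qB// -mulrN opprB.
Qed.

End bipolar.

Theorem lemma4 (R : realType) (alpha : R[i]) (halpha : unit_circle alpha)
    (d : measure_display) (T : measurableType d) (P : probability T R)
    (x : nat -> {RV P >-> R})
    (hx : forall (n : nat) (t : T), -1 < x n t < 1)
    (hstat : stationary x) (herg : ergodic x)
    (t : T) (n : nat) (z : R[i])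
    (hz : (unit_disk `\` [set - alpha; alpha]) z) :
  tau alpha (U alpha (fun k => x k t) n z)
    = tau alpha z + omega (fun k => x k t) n
  /\ sigma alpha (U alpha (fun k => x k t) n z) = sigma alpha z.
Proof.
rewrite /U /g; set w := omega _ n.
have [y [[hy ew] _]] := log_ratio_bij w.
(* The preimage [y] shows that the set is inhabited, so [get] returns one of its elements and not a
   default value. *)
have [hy' ew'] : [set y | -1 < y < 1 /\ w = log_ratio y]
    (get [set y | -1 < y < 1 /\ w = log_ratio y]).
  by apply: getPex; exists y.
have [hz1 hz2] := hz.
split; last exact: sigma_q.
rewrite [in RHS]ew'; apply: tau_q => //.
- by apply/eqP => e; apply: hz2; right.
- by apply/eqP => e; apply: hz2; left.
Qed.
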